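(* For a vector $\mathbf{v}=(v_1,\dots,v_n)$ of nonzero reals define $$\gamma^{\min}(\mathbf{v}):=\min_{\mathbf{s}\in[0,1]^n}\ \sup_{t\in\mathbb{R}}\ \min_{i\in\{1,\dots,n\}} \operatorname{dist}(s_i+v_i t,\mathbb{Z}).$$ Then: $$\gamma^{\min}(1,2,3,4,5)=\tfrac{15}{94}<\tfrac16,$$ $$\gamma^{\min}(2,3,4,5,6,8)=\tfrac{2}{15}<\gamma^{\min}(1,2,3,4,5,6)=\tfrac{9}{67}<\tfrac17,$$ and $\gamma^{\min}(1,2,\dots,n)<\frac{1}{n+1}$ for every $n\in\{7,\dots,17\}$. In particular, for every $n\in\{5,\dots,17\}$ there are positive integers $v_1,\dots,v_n$, pairwise distinct, such that $\gamma^{\min}(v_1,\dots,v_n)<\frac1{n+1}$.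
   Context: $\operatorname{dist}(x,\mathbb{Z})$ denotes the distance from the real number $x$ to the nearest integer. *)

(* Defs.v *)
From HB Require Import structures.
From mathcomp Require Import all_boot all_order all_algebra.
From mathcomp Require Import lra.
From mathcomp Require Import all_classical all_reals.
From mathcomp Require Import topology normedtype derive.
Set Implicit Arguments.
Unset Strict Implicit.
Unset Printing Implicit Defensive.
Import Order.TTheory GRing.Theory Num.Theory.
Import numFieldNormedType.Exports.
Local Open Scope classical_set_scope.
Local Open Scope ring_scope.

Definition distZ {R : realType} (x : R) : R :=
  inf [set `|x - m%:~R| | m in [set: int]].

Definition unit_cube (R : realType) (n : nat) : set 'rV[R]_n :=
  [set s | forall i, s ord0 i \in `[0, 1]].

(* Since distZ <= 1/2 (distZ_le_half), the initial value 1/2 does not affect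
   the minimum when n > 0. *)
Definition min_distZ {R : realType} {n : nat} (s v : 'rV[R]_n) (t : R) : R :=
  \big[Num.min/2^-1]_(i < n) distZ (s ord0 i + v ord0 i * t).

Definition sup_min_distZ {R : realType} {n : nat} (s v : 'rV[R]_n) : R :=
  sup [set min_distZ s v t | t in [set: R]].

(* The infimum is a minimum, by gamma_min_attained. *)
Definition gamma_min {R : realType} {n : nat} (v : 'rV[R]_n) : R :=
  inf [set sup_min_distZ s v | s in @unit_cube R n].

(* (1, 2, ..., n) *)
Definition first_positives (R : realType) (n : nat) : 'rV[R]_n :=
  \row_(i < n) i.+1%:R.

Section Basics.
Context {R : realType}.
Implicit Types x y t : R.

Lemma distZ_le x (m : int) : distZ x <= `|x - m%:~R|.
Proof. by apply: ge_inf; [exists 0 => _ [k _ <-] | exists m]. Qed.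

Lemma distZ_ge x c : (forall m : int, c <= `|x - m%:~R|) -> c <= distZ x.
Proof.
move=> h; apply: lb_le_inf; first by exists `|x - 0%:~R|; exists 0.
by move=> _ [m _ <-].
Qed.

Lemma distZ_ge0 x : 0 <= distZ x.
Proof. exact: distZ_ge. Qed.

Lemma distZ_le_half x : distZ x <= 2^-1.
Proof.
have := Num.Theory.floor_itv x; rewrite intrD => /andP[h1 h2].
have := distZ_le x (Num.floor x); have := distZ_le x (Num.floor x + 1).
rewrite intrD ler0_norm ?ger0_norm; lra.
Qed.

Lemma distZ_lipschitz x y : distZ x <= distZ y + `|x - y|.
Proof.
rewrite -lerBlDr; apply: distZ_ge => m; rewrite lerBlDr.
apply: le_trans (distZ_le x m) _; rewrite [leRHS]addrC.
by rewrite -[x - m%:~R](subrKA y) ler_normD.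
Qed.

Context {n : nat}.
Implicit Types s v : 'rV[R]_n.

Lemma min_distZ_attained s v t : (0 < n)%N ->
  exists i, min_distZ s v t = distZ (s ord0 i + v ord0 i * t).
Proof.
move=> n0; have i0 : 'I_n := Ordinal n0.
rewrite /min_distZ (bigmin_eq_arg _ i0) //; last first.
  by move=> i _; exact: distZ_le_half.
by eexists.
Qed.

Lemma min_distZ_le_half s v t : min_distZ s v t <= 2^-1.
Proof. exact: bigmin_le_id. Qed.

Lemma has_sup_min_distZ s v : has_sup [set min_distZ s v t | t in [set: R]].
Proof.
split; first by exists (min_distZ s v 0); exists 0.
by exists 2^-1 => _ [t _ <-]; exact: min_distZ_le_half.
Qed.

Lemma sup_min_distZ_lipschitz s s' v :
  sup_min_distZ s v <= sup_min_distZ s' v + `|s - s'|.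
Proof.
apply: ge_sup; first by case: (has_sup_min_distZ s v).
move=> _ [t _ <-]; rewrite -lerBlDr.
apply: (@le_trans _ _ (min_distZ s' v t)); last first.
  by apply: sup_upper_bound; [exact: has_sup_min_distZ | exists t].
rewrite lerBlDr.
have ss0 : 0 <= `|s - s'| by [].
rewrite -lerBlDr; apply/bigmin_geP; split.
  by rewrite lerBlDr; have := min_distZ_le_half s v t; lra.
move=> i _; rewrite lerBlDr.
apply: (@le_trans _ _ (distZ (s ord0 i + v ord0 i * t))); first exact: bigmin_le.
apply: le_trans (distZ_lipschitz _ (s' ord0 i + v ord0 i * t)) _.
rewrite lerD2l opprD addrACA subrr addr0.
rewrite [leRHS]/Num.norm /= mx_normrE.
by apply/bigmax_geP; right; exists (ord0, i) => //=; rewrite !mxE.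
Qed.

Lemma continuous_sup_min_distZ v :
  continuous (fun s : 'rV[R]_n => sup_min_distZ s v : R).
Proof.
move=> s; apply/(@cvgrPdist_le _ _ _ (nbhs s) (nbhs_filter s)) => e e0.
apply: (@filterS _ (nbhs s) _ (ball s e)); last exact: nbhsx_ballx.
move=> s'; rewrite mx_norm_ball /ball_ /= => /ltW d.
have := sup_min_distZ_lipschitz s s' v.
have := sup_min_distZ_lipschitz s' s v.
by rewrite (distrC s' s) ler_norml; lra.
Qed.

Lemma compact_unit_cube : compact (@unit_cube R n).
Proof. by apply: (@rV_compact R n (fun=> `[0, 1]%classic)) => _; exact: segment_compact. Qed.

Lemma gamma_min_attained v :
  (exists2 s, unit_cube s & sup_min_distZ s v = gamma_min v) /\
  (forall s, unit_cube s -> gamma_min v <= sup_min_distZ s v).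
Proof.
have cube0 : @unit_cube R n !=set0.
  by exists 0 => i; rewrite mxE in_itv /= lexx ler01.
have [|c] := EVT_min_rV cube0 compact_unit_cube (f := fun s => sup_min_distZ s v).
  by apply: continuous_subspaceT; exact: continuous_sup_min_distZ.
rewrite inE => cc cmin.
have cle s : unit_cube s -> sup_min_distZ c v <= sup_min_distZ s v.
  by move=> us; apply: cmin; rewrite inE.
suff <- : sup_min_distZ c v = gamma_min v by split=> //; exists c.
apply/eqP; rewrite eq_le; apply/andP; split.
  apply: lb_le_inf; first by exists (sup_min_distZ c v); exists c.
  by move=> _ [s us <-]; exact: cle.
apply: ge_inf; last by exists c.
by exists (sup_min_distZ c v) => _ [s us <-]; exact: cle.
Qed.

End Basics.

(* Main.v *)
(* Runner i is within gamma of an integer exactly when t lies in one of v_i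
   equally spaced arcs of the circle R/Z, each of radius gamma / v_i, and s_i
   only rotates this family of arcs.  Hence gamma_min v <= gamma as soon as some
   rotations make the closed arcs cover the circle; such rotations are given
   explicitly and a left-to-right sweep over the sorted arcs checks the cover.
   Conversely gamma <= gamma_min v when no rotations make the open arcs cover.
   In an open cover the right endpoint of each arc lies in an arc of another
   runner, which confines a difference of two rotations to one of finitely many
   open intervals.  A backtracking search over these choices, propagating strict
   bounds on all differences, shows that they are inconsistent. *)
Require Import Defs.
From Stdlib Require Import ZArith.
From mathcomp Require Import all_boot all_order all_algebra.
From mathcomp Require Import zify ssrZ ring lra.
From mathcomp Require Import all_classical all_reals.
Set Implicit Arguments.
Unset Strict Implicit.
Unset Printing Implicit Defensive.
Import Order.TTheory GRing.Theory Num.Theory.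
Local Open Scope ring_scope.
Delimit Scope Z_scope with BZ.

(** * Transfer of integer arithmetic to the reals *)

Section ZtoR.
Context {R : realType}.
Implicit Types a b : Z.

Definition Z2R a : R := (int_of_Z a)%:~R.

Lemma Z2RD a b : Z2R (a + b)%BZ = Z2R a + Z2R b.
Proof. by rewrite /Z2R -intrD -raddfD. Qed.

Lemma Z2RN a : Z2R (- a)%BZ = - Z2R a.
Proof. by rewrite /Z2R -[RHS]raddfN -raddfN. Qed.

Lemma Z2RB a b : Z2R (a - b)%BZ = Z2R a - Z2R b.
Proof. by rewrite -Z2RN -Z2RD. Qed.

Lemma Z2RM a b : Z2R (a * b)%BZ = Z2R a * Z2R b.
Proof. by rewrite /Z2R -intrM -rmorphM. Qed.

Lemma Z2R_le a b : (Z2R a <= Z2R b) = (a <=? b)%BZ.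
Proof. rewrite /Z2R ler_int; lia. Qed.

Lemma Z2R_lt a b : (Z2R a < Z2R b) = (a <? b)%BZ.
Proof. rewrite /Z2R ltr_int; lia. Qed.

Lemma Z2R_ltD1 a b : Z2R a < Z2R b -> Z2R a + 1 <= Z2R b.
Proof. by rewrite /Z2R -[1]/(1%:~R) -intrD ler_int ltr_int lezD1. Qed.

Lemma Z2R_min a b : Z2R (Z.min a b) = Num.min (Z2R a) (Z2R b).
Proof. by rewrite minElt Z2R_lt; case: ifP => h; congr Z2R; lia. Qed.

Lemma Z2R_nat k : Z2R (Z.of_nat k) = k%:R.
Proof. by rewrite /Z2R pmulrn; congr (_%:~R); lia. Qed.

Lemma Z2R_int (m : int) : Z2R (Z_of_int m) = m%:~R.
Proof. by rewrite /Z2R Z_of_intK. Qed.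

End ZtoR.

(** The product test also excludes [v = 0], since [L] is positive. *)
Lemma Z2R_divisor (R : realType) (v : nat) L :
  (0 <? L)%BZ -> (Z.of_nat v * (L / Z.of_nat v) =? L)%BZ ->
  [/\ 0 < v%:R :> R, 0 < Z2R (L / Z.of_nat v)%BZ :> R &
     v%:R * Z2R (L / Z.of_nat v)%BZ = Z2R L :> R].
Proof.
rewrite -(@Z2R_lt R 0) => L0 /Z.eqb_eq e.
have vw : v%:R * Z2R (L / Z.of_nat v)%BZ = Z2R L :> R by rewrite -Z2R_nat -Z2RM e.
have v0 : 0 < v%:R :> R.
  by rewrite lt0r ler0n andbT; apply/eqP => v0; move: L0; rewrite -vw v0 mul0r ltxx.
by split=> //; rewrite -(pmulr_rgt0 _ v0) vw.
Qed.

Lemma Z_offset_nat (m : Z) k : (-1 <=? m)%BZ -> (m <=? Z.of_nat k)%BZ ->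
  exists2 l, (l < k.+2)%N & m = (Z.of_nat l - 1)%BZ.
Proof. by move=> h1 h2; exists (Z.to_nat (m + 1)); lia. Qed.

(** * Bounds on the minimum from covers of the time line *)

Section GammaMinBounds.
Context {R : realType} {n : nat}.
Implicit Types (s v : 'rV[R]_n) (g : R).

(** Here [s] may lie outside the cube: subtracting the floors of its entries changes no distance to
    the integers. *)
Lemma gamma_min_le v s g : (0 < n)%N ->
  (forall t, exists i (m : int), `|s ord0 i + v ord0 i * t - m%:~R| <= g) ->
  gamma_min v <= g.
Proof.
move=> n0 h; pose s' : 'rV[R]_n := \row_i (s ord0 i - (Num.floor (s ord0 i))%:~R).
have us' : unit_cube s'.
  move=> i; rewrite mxE in_itv /=.
  by have := floor_itv (s ord0 i); rewrite intrD; lra.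
apply: le_trans ((gamma_min_attained v).2 _ us') _.
apply: ge_sup; first by case: (has_sup_min_distZ s' v).
move=> _ [t _ <-]; have [i [m im]] := h t.
apply: (@le_trans _ _ (distZ (s' ord0 i + v ord0 i * t))); first exact: bigmin_le.
apply: le_trans (distZ_le _ (m - Num.floor (s ord0 i))) _.
by rewrite mxE intrB; apply: le_trans im; rewrite le_eqVlt; apply/orP; left; apply/eqP; congr `|_|; lra.
Qed.

(** For a minimising [s] some time [t] stays uncovered and bounds the supremum from below;
    [g <= 2^-1] takes care of the initial value of the minimum. *)
Lemma gamma_min_ge v g : g <= 2^-1 ->
  (forall s, ~ forall t, exists i (m : int), `|s ord0 i + v ord0 i * t - m%:~R| < g) ->
  g <= gamma_min v.
Proof.
move=> g2 h; have [[s _ <-] _] := gamma_min_attained v.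
have [t ht] : exists t, ~ exists i (m : int), `|s ord0 i + v ord0 i * t - m%:~R| < g.
  by apply/existsNP; exact: h.
apply: le_trans (_ : min_distZ s v t <= _); last first.
  by apply: sup_upper_bound; [exact: has_sup_min_distZ | exists t].
apply/bigmin_geP; split=> // i _; apply: distZ_ge => m.
by rewrite leNgt; apply/negP => lt; apply: ht; exists i, m.
Qed.

End GammaMinBounds.

Definition speed_row (R : realType) (vs : seq nat) : 'rV[R]_(size vs) :=
  \row_i (nth 0%N vs i)%:R.

(** * Upper bounds: checked covers of the circle *)

Section Cover.
Implicit Types (T L num den q : Z) (a : Z * Z).

(** [T] is the end of the stretch covered so far. An arc starting beyond it leaves it unchanged, so
    the sweep is sound for arcs in any order. *)
Definition sweep T a := if (a.1 <=? T)%BZ then Z.max T a.2 else T.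

(* The circle is scaled to length L * den, where every v divides L, so that the
   arcs of runner v have the integral period (L / v) * den and, for
   gamma = num / den, radius (L / v) * num; q is the centre of one of them. *)
Definition arcs L num den (v : Z) q : seq (Z * Z) :=
  let w := (L / v)%BZ in
  [seq let c := (q + (Z.of_nat k - 1) * (w * den))%BZ in
       (c - w * num, c + w * num)%BZ | k <- iota 0 (Z.to_nat v).+2].

Definition covers (vs : seq nat) L num den (qs : seq Z) : bool :=
  [&& (0 <? den)%BZ, (0 <? L)%BZ, all (fun v => (Z.of_nat v * (L / Z.of_nat v) =? L)%BZ) vs &
   (L * den <=? foldl sweep 0 (sort (fun a b => a.1 <=? b.1)
     (flatten [seq arcs L num den (Z.of_nat (nth 0%N vs i)) (nth 0 qs i)
              | i <- iota 0 (size vs)])))%BZ].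

Lemma sweep_covers (R : realType) (s : seq (Z * Z)) T (x : R) :
  Z2R T <= x < Z2R (foldl sweep T s) ->
  exists2 a, a \in s & Z2R a.1 <= x <= Z2R a.2.
Proof.
elim: s T => [|a s IH] T /=; first lra.
have [lt|ge] := ltP x (Z2R (sweep T a)); last first.
  move=> /andP[_ h]; have [|b bs hb] := IH (sweep T a); first by rewrite ge h.
  by exists b => //; rewrite inE bs orbT.
move=> /andP[h _]; exists a; first exact: mem_head.
move: lt; rewrite /sweep; case: ifP => [|_]; last lra.
rewrite -(@Z2R_le R) => aT lt; apply/andP; split; first lra.
case: (Z.max_spec T a.2) lt => -[_ ->]; last lra.
by move/ltW.
Qed.

Lemma gamma_min_cover (R : realType) vs L num den qs :
  covers vs L num den qs ->
  gamma_min (speed_row R vs) <= Z2R num / Z2R den.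
Proof.
case/and4P => + L_gt0 /allP vL; have := L_gt0; rewrite -!(@Z2R_lt R) -(@Z2R_le R) Z2RM => L0 d0.
set s := sort _ _ => cov.
have {}d0 : 0 < Z2R den :> R := d0; have {}L0 : 0 < Z2R L :> R := L0.
have arc (x : R) : 0 <= x < Z2R L * Z2R den -> exists (i : 'I_(size vs)) (k : Z),
    `|x - Z2R (nth 0 qs i) - Z2R k * (Z2R (L / Z.of_nat (nth 0%N vs i))%BZ * Z2R den)|
    <= Z2R (L / Z.of_nat (nth 0%N vs i))%BZ * Z2R num.
  move=> /andP[x0 xC]; have [|a] := @sweep_covers R s 0%BZ x.
    by rewrite x0 /=; exact: lt_le_trans xC cov.
  rewrite /s mem_sort => /flatten_mapP[i]; rewrite mem_iota add0n /= => i_lt /mapP[k _ ->] /=.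
  rewrite !(Z2RD, Z2RB, Z2RM) => h; exists (Ordinal i_lt), (Z.of_nat k - 1)%BZ => /=.
  by rewrite ler_norml Z2RB; lra.
(* With this shift, runner [i] is at an integer when [t] is the fraction [q_i / (L * den)] of a
   turn. *)
apply: (gamma_min_le (s := \row_i (- ((nth 0%N vs i)%:R * Z2R (nth 0 qs i) / (Z2R L * Z2R den))))) => [|t].
  (* An arc over 0 shows that there is at least one runner. *)
  have [|i _] := arc 0; last exact: leq_ltn_trans (ltn_ord i).
  by rewrite lexx mulr_gt0.
pose z := Num.floor t.
have /andP[zt tz] := floor_itv t; rewrite intrD -/z in zt tz.
have [|i [k hk]] := arc ((t - z%:~R) * (Z2R L * Z2R den)).
  rewrite mulr_ge0 /=; [|lra|by rewrite mulr_ge0 ?ltW].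
  by rewrite -[ltRHS]mul1r ltr_pM2r ?mulr_gt0//; lra.
(* The [z] full turns removed from [t] advance runner [i] by [v_i * z]. *)
exists i, (int_of_Z k + (nth 0%N vs i)%:Z * z); rewrite !mxE.
set w := Z2R (L / _)%BZ in hk.
have [v0 w0 vwL] := Z2R_divisor R L_gt0 (vL _ (mem_nth 0%N (ltn_ord i))).
rewrite -/w in w0 vwL.
have wd0 : 0 < w * Z2R den by rewrite mulr_gt0.
rewrite -(ler_pM2l wd0) -[X in X * `|_|](gtr0_norm wd0) -normrM.
rewrite mulrCA mulfK ?gt_eqF// [leRHS]mulrC.
apply: le_trans hk; rewrite le_eqVlt; apply/orP; left; apply/eqP; congr `|_|.
rewrite intrD intrM -vwL -/(Z2R k).
by field; apply/and3P; split; rewrite gt_eqF.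
Qed.

End Cover.

(* (i, j, lo, hi) stands for lo < x j - x i < hi; likewise entry (i, j) of a
   matrix of bounds bounds x j - x i from above. *)
Definition constr : Type := nat * nat * Z * Z.

(** * Difference constraints and the backtracking search *)

Section DifferenceConstraints.
Implicit Types (D : seq (seq Z)) (c : constr) (cl : seq constr).

Definition bound D i j : Z := nth 0%BZ (nth [::] D i) j.

(** Shortest-path update for a new edge from [i] to [j] of weight [b]: each bound is compared with
    the path through that edge. *)
Definition tighten i j b D : seq (seq Z) :=
  if (bound D i j <=? b)%BZ then D else
  let rj := nth [::] D j in
  [seq let e := (nth 0 r i + b)%BZ in
       [seq Z.min p.1 (e + p.2)%BZ | p <- zip r rj] | r <- D].

Definition impose c D : seq (seq Z) :=
  let: (i, j, lo, hi) := c in tighten j i (- lo)%BZ (tighten i j hi D).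

Definition possible D c : bool :=
  let: (i, j, lo, hi) := c in
  ((lo <? bound D i j) && (- bound D j i <? hi))%BZ.

Definition implied D c : bool :=
  let: (i, j, lo, hi) := c in
  ((bound D i j <=? hi) && (lo <=? - bound D j i))%BZ.

Definition shortest (cl : seq constr) (cls : seq (seq constr)) : seq constr :=
  foldl (fun cl1 cl2 => if (size cl2 < size cl1)%N then cl2 else cl1) cl cls.

(** Each clause is a disjunction. An emptied clause closes the branch: it is a shortest one and
    [all] holds vacuously on it. Running out of clauses or fuel refutes nothing. *)
Fixpoint refute (fuel : nat) (cls : seq (seq constr)) D : bool :=
  if fuel is fuel'.+1 then
    let cls' := [seq cl <- [seq [seq c <- cl | possible D c] | cl <- cls]
                | ~~ has (implied D) cl] in
    if cls' is cl :: rest then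
      all (fun c => refute fuel' cls' (impose c D)) (shortest cl rest)
    else false
  else false.

Lemma mem_shortest cl cls : shortest cl cls \in cl :: cls.
Proof.
elim: cls cl => [|cl' cls IH] cl /=; first by rewrite mem_head.
rewrite /shortest /= -/(shortest _ _).
have := IH (if (size cl' < size cl)%N then cl' else cl).
by case: ifP => _; rewrite !inE => /orP[->|->]; rewrite ?orbT.
Qed.

Context {R : realType} (n : nat) (x : nat -> R).

Definition satisfies c : Prop :=
  let: (i, j, lo, hi) := c in
  [/\ (i < n)%N, (j < n)%N & Z2R lo < x j - x i < Z2R hi].

(* Off the diagonal the bounds are strict; the diagonal is weak so that it can
   be initialised at 0. *)
Definition bounded_by D : Prop :=
  [/\ size D = n, forall r, r \in D -> size r = n &
   forall i j, (i < n)%N -> (j < n)%N ->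
     x j - x i < Z2R (bound D i j) ?<= if (i == j)].

Lemma tighten_bounded i j b D : (i < n)%N -> (j < n)%N ->
  x j - x i < Z2R b -> bounded_by D -> bounded_by (tighten i j b D).
Proof.
rewrite /tighten; case: ifP => // _ il jl lt [sD sr bD].
have sz k : (k < n)%N -> size (nth [::] D k) = n by move=> kl; rewrite sr// mem_nth ?sD.
split; first by rewrite size_map.
  by move=> _ /mapP[r rD ->]; rewrite size_map size_zip sr// sz// minnn.
move=> k l kl ll; rewrite /bound (nth_map [::]) ?sD//.
rewrite (nth_map (0, 0)%BZ) ?size_zip ?sz ?minnn// nth_zip ?sz//=.
rewrite Z2R_min -!/(bound _ _ _) lteif_minr bD//=.
(* The bound [b] is strict, so the path through the new edge is strict even on the diagonal. *)
apply: ltrW_lteif; rewrite !Z2RD.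
have /lteifW := bD k i kl il; have /lteifW := bD j l jl ll; lra.
Qed.

Lemma impose_bounded c D : satisfies c -> bounded_by D -> bounded_by (impose c D).
Proof.
case: c => [[[i j] lo] hi] [il jl /andP[lt1 lt2]] bD.
apply: tighten_bounded => //; first by rewrite Z2RN ltrNr opprB.
exact: tighten_bounded.
Qed.

Lemma satisfies_possible c D : satisfies c -> bounded_by D -> possible D c.
Proof.
case: c => [[[i j] lo] hi] [il jl /andP[lt1 lt2]] [_ _ bD] /=.
have /lteifW := bD _ _ il jl; have /lteifW := bD _ _ jl il.
by rewrite -!(@Z2R_lt R) Z2RN => h1 h2; apply/andP; split; lra.
Qed.

(** A satisfied alternative survives the filter and imposing it keeps the bounds true, so the
    induction hypothesis applies to its branch. *)
Lemma refute_sound fuel cls D : bounded_by D -> refute fuel cls D ->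
  ~ forall cl, cl \in cls -> exists2 c, c \in cl & satisfies c.
Proof.
elim: fuel cls D => [//|fuel IH] cls D bD /=.
set cls' := [seq cl <- _ | _] => ref sat.
have sat' cl : cl \in cls' -> exists2 c, c \in cl & satisfies c.
  rewrite mem_filter => /andP[_ /mapP[cl0 /sat[c cin csat] ->]].
  by exists c => //; rewrite mem_filter cin andbT satisfies_possible.
case E: cls' ref => [//|cl rest] /allP ref.
have [|c cin csat] := sat' (shortest cl rest); first by rewrite E mem_shortest.
have := ref c cin; rewrite -E; move/(IH _ _ (impose_bounded csat bD)); exact.
Qed.

End DifferenceConstraints.

(** * Lower bounds: impossibility of open covers *)

Section Refutation.
Implicit Types (vs : seq nat) (L num den : Z).

Definition period vs L den i : Z := (L / Z.of_nat (nth 0%N vs i) * den)%BZ.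

Definition radius vs L num i : Z := (L / Z.of_nat (nth 0%N vs i) * num)%BZ.

(* The ways for the right endpoint of the k-th arc of runner i to lie in an arc
   of another runner, for centres normalised as in initial_bounds. *)
Definition endpoint_clause vs L num den i k : seq constr :=
  let a := (Z.of_nat k * period vs L den i + radius vs L num i)%BZ in
  flatten [seq let p := period vs L den j in let r := radius vs L num j in
    [seq let b := (a - (Z.of_nat l - 1) * p)%BZ in (i, j, b - r, b + r)%BZ
    | l <- iota 0 (nth 0%N vs j).*2.+2] | j <- iota 0 (size vs) & j != i].

Definition endpoint_clauses vs L num den : seq (seq constr) :=
  flatten [seq [seq endpoint_clause vs L num den i k | k <- iota 0 (nth 0%N vs i)]
          | i <- iota 0 (size vs)].

(* Bounds for centres with x 0 <= x i < x 0 + period i; the first inequality is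
   weak, hence the slack 1. *)
Definition initial_bounds vs L den : seq (seq Z) :=
  [seq [seq if i == j then 0%BZ else if j == 0%N then 1%BZ else period vs L den j
       | j <- iota 0 (size vs)] | i <- iota 0 (size vs)].

Definition uncoverable vs L num den fuel : bool :=
  [&& (0 <? num)%BZ, (0 <? den)%BZ, (2 * num <=? den)%BZ, (0 <? L)%BZ,
      all (fun v => (Z.of_nat v * (L / Z.of_nat v) =? L)%BZ) vs &
      refute fuel (endpoint_clauses vs L num den) (initial_bounds vs L den)].

(** The cover is used only at the right endpoints of the arcs in one turn; each gives a satisfied
    alternative of its clause. *)
Lemma uncoverable_sound (R : realType) vs L num den fuel (x : nat -> R) :
  uncoverable vs L num den fuel ->
  ~ forall T, exists i (m : Z), (i < size vs)%N /\
      `|T - x i - Z2R m * Z2R (period vs L den i)| < Z2R (radius vs L num i).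
Proof.
case/andP => + /and5P[+ + L_gt0 /allP vL ref] cov.
rewrite -!(@Z2R_lt R) -!(@Z2R_le R) => num0 d0 numden.
pose n := size vs; pose P i : R := Z2R (period vs L den i).
pose r i : R := Z2R (radius vs L num i).
pose V i : R := (nth 0%N vs i)%:R.
have {}num0 : 0 < Z2R num :> R := num0; have {}d0 : 0 < Z2R den :> R := d0.
have VP i : (i < n)%N -> V i * P i = Z2R L * Z2R den.
  move=> il; have [_ _ e] := Z2R_divisor R L_gt0 (vL _ (mem_nth 0%N il)).
  by rewrite /P /period Z2RM mulrA e.
have P0 i : (i < n)%N -> 0 < P i.
  move=> il; have [_ w0 _] := Z2R_divisor R L_gt0 (vL _ (mem_nth 0%N il)).
  by rewrite /P /period Z2RM mulr_gt0.
have Pr i : (i < n)%N -> 2 * r i <= P i.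
  move=> il; have := P0 i il; rewrite /P /r /period /radius !Z2RM pmulr_lgt0// => w0.
  by rewrite mulrCA ler_pM2l//; move: numden; rewrite Z2RM (Z2R_nat 2).
(* Whole periods move each centre into the period starting at [x 0], as [initial_bounds]
   requires. *)
pose f i : int := Num.floor ((x i - x 0%N) / P i).
pose y i := x i - (f i)%:~R * P i.
have y_ge i : (i < n)%N -> y 0%N <= y i < y 0%N + P i.
  move=> il; have Pi := P0 i il.
  have y0 : y 0%N = x 0%N by rewrite /y /f subrr mul0r floor0 mul0r subr0.
  have := floor_itv ((x i - x 0%N) / P i); rewrite -/(f i) intrD y0 /y.
  rewrite ler_pdivlMr// ltr_pdivrMr// => /andP[h1 h2].
  by apply/andP; split; lra.
have {}cov T : exists i (m : Z), (i < n)%N /\ `|T - y i - Z2R m * P i| < r i.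
  have [i [m [il h]]] := cov T; exists i, (m + Z_of_int (f i))%BZ; split => //.
  by rewrite Z2RD Z2R_int; apply: le_lt_trans h; rewrite -/(P i) /y le_eqVlt; apply/orP; left;
    apply/eqP; congr `|_|; ring.
apply: (refute_sound (x := y) (n := n) _ ref).
  split; rewrite ?size_map ?size_iota//.
    by move=> _ /mapP[i _ ->]; rewrite size_map size_iota.
  move=> i j il jl; rewrite /bound.
  rewrite (nth_map 0%N) ?size_iota// (nth_map 0%N) ?size_iota// !nth_iota// !add0n.
  case: eqP => [->|_] /=; first by rewrite subrr.
  have /andP[h1 h2] := y_ge i il; have /andP[h3 h4] := y_ge j jl.
  have e1 : Z2R 1%BZ = 1 :> R by [].
  by case: eqP => [j0|_]; [rewrite j0 e1; lra|rewrite -/(P j); lra].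
move=> cl /flatten_mapP[i]; rewrite mem_iota add0n => /= il /mapP[k]; rewrite mem_iota add0n => /= kl ->.
have [j [m [jl hj]]] := cov (y i + k%:R * P i + r i).
(* Since [2 * r i <= P i], the open arcs of runner [i] are disjoint and miss this endpoint. *)
have ij : j != i.
  apply/eqP => ji; move: hj; rewrite ji.
  have -> : y i + k%:R * P i + r i - y i - Z2R m * P i = Z2R (Z.of_nat k - m)%BZ * P i + r i.
    by rewrite Z2RB Z2R_nat; ring.
  have Pi := P0 i il; have ri := Pr i il.
  have [h|h] := Z_le_gt_dec 0 (Z.of_nat k - m)%BZ.
    have : 0 <= Z2R (Z.of_nat k - m)%BZ :> R by rewrite (@Z2R_le R 0); apply/Z.leb_le.
    move=> h0; have := mulr_ge0 h0 (ltW Pi).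
    by rewrite ltr_norml; lra.
  have h0 : Z2R (Z.of_nat k - m)%BZ <= -1 :> R by rewrite (@Z2R_le R _ (-1)%BZ); apply/Z.leb_le; lia.
  have : Z2R (Z.of_nat k - m)%BZ * P i <= -1 * P i by rewrite ler_pM2r.
  by rewrite ltr_norml; lra.
have Pi := P0 i il; have Pj := P0 j jl; have ri := Pr i il; have rj := Pr j jl.
have /andP[yi1 yi2] := y_ge i il; have /andP[yj1 yj2] := y_ge j jl.
have r0 : 0 < r i.
  rewrite /r /radius Z2RM mulr_gt0//.
  by move: Pi; rewrite /P /period Z2RM pmulr_lgt0.
have kP0 : 0 <= k%:R * P i := mulr_ge0 (ler0n _ _) (ltW Pi).
have kP : k%:R * P i <= Z2R L * Z2R den - P i.
  rewrite -(VP i il) -[X in _ - X]mul1r -mulrBl ler_pM2r// lerBrDr.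
  by rewrite /V -[1]/(1%:R) -natrD ler_nat addn1.
move: hj; rewrite ltr_norml => /andP[hj1 hj2].
(* The endpoint lies less than [2 * L * den], that is [2 * v_j] periods of runner [j], past [y 0],
   and [y j - y i < P j]; this confines [m] to the range from -1 to [2 * v_j]. *)
have m_ge : (-1 <=? m)%BZ.
  rewrite -(@Z2R_le R) leNgt; apply/negP => /Z2R_ltD1.
  by rewrite (_ : Z2R (-1) = -1)// -(ler_pM2r Pj) mulrDl; lra.
have m_le : (m <=? Z.of_nat (nth 0%N vs j).*2)%BZ.
  rewrite -(@Z2R_le R) leNgt; apply/negP => /Z2R_ltD1.
  by rewrite Z2R_nat -mul2n natrM -(ler_pM2r Pj) mulrDl -mulrA VP//; lra.
exists (i, j, Z.of_nat k * period vs L den i + radius vs L num i - m * period vs L den j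
    - radius vs L num j,
  Z.of_nat k * period vs L den i + radius vs L num i - m * period vs L den j
    + radius vs L num j)%BZ.
  apply/flatten_mapP; exists j; first by rewrite mem_filter ij mem_iota.
  have [l l_lt ->] := Z_offset_nat m_ge m_le.
  by apply/mapP; exists l; rewrite // mem_iota.
split=> //; rewrite !(Z2RD, Z2RB, Z2RM (Z.of_nat k), Z2RM m, Z2R_nat) -/(P i) -/(P j) -/(r i) -/(r j).
by apply/andP; split; lra.
Qed.

Lemma gamma_min_uncoverable (R : realType) vs L num den fuel :
  uncoverable vs L num den fuel ->
  Z2R num / Z2R den <= gamma_min (speed_row R vs).
Proof.
move=> unc; have /andP[_ /and5P[d0 numden L_gt0 /allP vL _]] := unc.
have {}d0 : 0 < Z2R den :> R by rewrite (@Z2R_lt R 0).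
apply: gamma_min_ge => [|s cov].
  rewrite ler_pdivrMr//; move: numden; rewrite -(@Z2R_le R) Z2RM (Z2R_nat 2); lra.
(* Runner [i] is at an integer at the fraction [- s_i / v_i] of a turn, which is [- P_i * s_i] on
   the circle of length [L * den]. *)
pose x i : R := - (Z2R (period vs L den i) *
  (if insub i is Some i' then s ord0 (i' : 'I_(size vs)) else 0)).
apply: (uncoverable_sound (x := x) unc) => T.
have [i [m h]] := cov (T / (Z2R L * Z2R den)).
exists i, (Z_of_int m); split => //; rewrite /x valK Z2R_int.
have [v0 w0 vw] := Z2R_divisor R L_gt0 (vL _ (mem_nth 0%N (ltn_ord i))).
rewrite /radius /period !Z2RM; move: v0 w0 vw h; rewrite mxE.
set w := Z2R (L / _)%BZ => v0 w0 vw h.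
have wd0 : 0 < w * Z2R den by rewrite mulr_gt0.
move: h; rewrite -(ltr_pM2l wd0) -[X in X * `|_|](gtr0_norm wd0) -normrM.
rewrite [ltRHS]mulrCA mulfK ?gt_eqF// [ltRHS]mulrC.
apply: le_lt_trans; rewrite le_eqVlt; apply/orP; left; apply/eqP; congr `|_|.
rewrite -vw; field.
by rewrite !gt_eqF.
Qed.

End Refutation.

(** * Exact values and certificates *)

Lemma gamma_min_speed_row (R : realType) n (v : 'rV[R]_n) vs :
  size vs = n -> (forall i, v ord0 i = (nth 0%N vs i)%:R) ->
  gamma_min v = gamma_min (speed_row R vs).
Proof.
move=> vsn; case: n / vsn v => v h.
by congr gamma_min; apply/rowP => i; rewrite mxE -h.
Qed.

Lemma gamma_min_first_positives (R : realType) n :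
  gamma_min (first_positives R n) = gamma_min (speed_row R (iota 1 n)).
Proof.
apply: gamma_min_speed_row => [|i]; first exact: size_iota.
by rewrite mxE nth_iota.
Qed.

Lemma gamma_min_12345 (R : realType) : gamma_min (first_positives R 5) = 15 / 94.
Proof.
rewrite gamma_min_first_positives -(Z2R_nat 15) -(Z2R_nat 94).
apply/eqP; rewrite eq_le; apply/andP; split.
  (* 60 is the least common multiple of the speeds; the centres are in units of [1 / (60 * 94)] of a
     turn. *)
  apply: (@gamma_min_cover _ _ 60 15 94 [:: 0; 1350; 1030; 615; 174]%BZ).
  by vm_compute.
(* The fuel 40 bounds the depth of the search. *)
by apply: (@gamma_min_uncoverable _ _ 60 15 94 40); vm_compute.
Qed.

Lemma gamma_min_234568 (R : realType) :
  gamma_min (\row_(i < 6) ([:: 2; 3; 4; 5; 6; 8] : seq R)`_i) = 2 / 15.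
Proof.
rewrite (@gamma_min_speed_row _ _ _ [:: 2; 3; 4; 5; 6; 8]%N) //; last first.
  by move=> i; rewrite mxE; case: i => [[|[|[|[|[|[|]]]]]] ?].
rewrite -(Z2R_nat 2) -(Z2R_nat 15).
apply/eqP; rewrite eq_le; apply/andP; split.
  apply: (@gamma_min_cover _ _ 120 2 15 [:: 0; 271; 246; 168; 151; 156]%BZ).
  by vm_compute.
by apply: (@gamma_min_uncoverable _ _ 120 2 15 40); vm_compute.
Qed.

Lemma gamma_min_123456 (R : realType) : gamma_min (first_positives R 6) = 9 / 67.
Proof.
rewrite gamma_min_first_positives -(Z2R_nat 9) -(Z2R_nat 67).
apply/eqP; rewrite eq_le; apply/andP; split.
  apply: (@gamma_min_cover _ _ 60 9 67 [:: 0; 779; 555; 179; 803; 69]%BZ).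
  by vm_compute.
by apply: (@gamma_min_uncoverable _ _ 60 9 67 40); vm_compute.
Qed.

(* Rows n = 7, ..., 17: one arc centre for each of the runners 1, ..., n, in
   units of 1 / (100 (n + 1)), found by simulated annealing. *)
Definition centers : seq (seq Z) := [::
  [:: 0; 228; 125; 139; 148; 32; 43];
  [:: 0; 198; 144; 117; 130; 75; 19; 29];
  [:: 0; 324; 216; 161; 105; 106; 23; 6; 30];
  [:: 0; 181; 126; 107; 96; 81; 129; 6; 99; 18];
  [:: 0; 404; 269; 196; 102; 149; 10; 11; 92; 11; 59];
  [:: 0; 451; 312; 233; 179; 159; 112; 30; 69; 6; 40; 75];
  [:: 0; 431; 276; 185; 149; 124; 15; 144; 6; 94; 61; 101; 104];
  [:: 0; 257; 221; 153; 169; 117; 173; 27; 159; 45; 24; 58; 100; 99];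
  [:: 0; 307; 209; 162; 206; 111; 24; 15; 161; 26; 13; 131; 7; 91; 37];
  [:: 0; 602; 418; 250; 164; 192; 83; 99; 139; 33; 128; 75; 84; 25; 4; 81];
  [:: 0; 155; 300; 257; 223; 241; 243; 208; 198; 105; 86; 67; 81; 94; 21; 1; 45]
  ]%BZ.

(* 12252240 is the least common multiple of 1, ..., 17. *)
Lemma covers_centers : all
  (fun n => covers (iota 1 n) 12252240 99 (100 * Z.of_nat n.+1)
              [seq (12252240 * q)%BZ | q <- nth [::] centers (n - 7)])
  (iota 7 11).
Proof. by vm_compute. Qed.

(** From [n = 7] on, the covers have radius parameter [99 / (100 * (n + 1))], and the factor
    [99 / 100] makes the inequality strict; the cases 5 and 6 follow from the exact values. *)
Lemma gamma_min_first_positives_lt (R : realType) n : (5 <= n <= 17)%N ->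
  gamma_min (first_positives R n) < 1 / n.+1%:R.
Proof.
case/andP => n5 n17; have [n7|] := leqP 7 n; last first.
  case: n n5 n17 => [|[|[|[|[|[|[|]]]]]]] //= _ _ _.
    by rewrite gamma_min_12345; lra.
  by rewrite gamma_min_123456; lra.
have /(allP covers_centers) : n \in iota 7 11 by rewrite mem_iota n7 ltnS.
rewrite gamma_min_first_positives => /(gamma_min_cover R); move/le_lt_trans; apply.
rewrite Z2RM Z2R_nat (Z2R_nat 99) (Z2R_nat 100) invfM mulrA ltr_pM2r ?invr_gt0 ?ltr0n//.
lra.
Qed.

Theorem theorem1p17 (R : realType) :
  (gamma_min (first_positives R 5) = 15 / 94 /\ (15 / 94 : R) < 1 / 6) /\
  (gamma_min (\row_(i < 6) ([:: 2; 3; 4; 5; 6; 8] : seq R)`_i) = 2 / 15 /\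
   (2 / 15 : R) < gamma_min (first_positives R 6) /\
   gamma_min (first_positives R 6) = 9 / 67 /\
   (9 / 67 : R) < 1 / 7) /\
  (forall n : nat, (7 <= n <= 17)%N ->
     gamma_min (first_positives R n) < 1 / n.+1%:R) /\
  (forall n : nat, (5 <= n <= 17)%N ->
     exists v : 'I_n -> nat,
       [/\ forall i, (0 < v i)%N,
           injective v &
           gamma_min (\row_(i < n) (v i)%:R : 'rV[R]_n) < 1 / n.+1%:R]).
Proof.
split; first by split; [exact: gamma_min_12345 | lra].
split; first by rewrite gamma_min_234568 gamma_min_123456; do !split; lra.
split=> n n17.
  by apply: gamma_min_first_positives_lt; case/andP: n17 => /ltnW/ltnW -> ->.
exists (fun i => i.+1); split=> // [i j [/val_inj]//|].
exact: gamma_min_first_positives_lt.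
Qed.
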